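(* For each of the following five triples of boxes $(\mathtt P,\mathtt Q,\mathtt R)$, every box in $\mathrm{Conv}\{\mathtt P,\mathtt Q,\mathtt R\}\setminus\mathrm{Conv}\{\mathtt Q,\mathtt R\}$ collapses communication complexity: - $(\mathtt{PR},\ \mathtt P_0,\ \mathtt P_1)$; - $(\mathtt{PR},\ \mathtt P_0,\ \mathtt P_{\mathrm L}^{0111})$; - $(\mathtt{PR},\ \mathtt P_0,\ \mathtt P_{\mathrm L}^{1101})$; - $(\mathtt{PR},\ \mathtt P_{\mathrm L}^{0010},\ \mathtt P_{\mathrm L}^{1011})$; - $(\mathtt{PR},\ \mathtt P_{\mathrm L}^{1000},\ \mathtt P_{\mathrm L}^{1110})$.
   Context: A non-signalling box is a function $\mathtt P:\{0,1\}^4\to[0,\infty)$, $\mathtt P(a,b|x,y)$, with $\sum_{a,b}\mathtt P(a,b|x,y)=1$ for all $x,y$, such that $\sum_b\mathtt P(a,b|x,y)$ does not depend on $y$ and $\sum_a\mathtt P(a,b|x,y)$ does not depend on $x$. Define $\mathtt{PR}(a,b|x,y)=\frac12\mathbf 1_{a\oplus b=xy}$ and, for $\mu,\nu,\sigma,\tau\in\{0,1\}$, $\mathtt P_{\mathrm L}^{\mu\nu\sigma\tau}(a,b|x,y)=1$ if $a=\mu x\oplus\nu$ and $b=\sigma y\oplus\tau$, and $0$ otherwise. Set $\mathtt P_0=\mathtt P_{\mathrm L}^{0000}$ and $\mathtt P_1=\mathtt P_{\mathrm L}^{0101}$. Collapse of communication complexity. Alice knows $X\in\{0,1\}^n$,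 Bob knows $Y\in\{0,1\}^m$, and they share randomness (a random variable $\lambda$ independent of $X,Y$) and finitely many, say $N$, independent copies of a box $\mathtt P$ (with $N$ arbitrary). Each party uses its own side of each copy once, in an order and with input bits that it chooses adaptively as a function of its string, $\lambda$, and the output bits it has already received; for fixed $\lambda,X,Y$, the probability of output bits $(a_i,b_i)_{i\le N}$ is $\prod_{i=1}^N\mathtt P(a_i,b_i|x_i,y_i)$, where $x_i$ (resp. $y_i$) is the input Alice (resp. Bob) gives to copy $i$ when her (resp. his) outputs are $(a_j)_j$ (resp. $(b_j)_j$). Then Bob sends one bit to Alice, computed from $Y,\lambda$ and his outputs, and Alice outputs a bit computed from $X,\lambda$, her outputs and the received bit. The box $\mathtt P$ collapses communication complexity (is collapsing) if there is a fixed $p>\frac12$ such that for all $n,m$ and every $f:\{0,1\}^n\times\{0,1\}^m\to\{0,1\}$ there is such a one-bit protocol using copies of $\mathtt P$ for which, for all $X,Y$, Alice outputs $f(X,Y)$ with probability at least $p$. *)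

(* Defs.v *)
From HB Require Import structures.
From mathcomp Require Import all_boot all_order all_algebra.
From mathcomp Require Import all_classical all_reals all_analysis.

Set Implicit Arguments.
Unset Strict Implicit.
Unset Printing Implicit Defensive.

Import Order.TTheory GRing.Theory Num.Theory.
Import numFieldNormedType.Exports.
Local Open Scope classical_set_scope.
Local Open Scope ring_scope.

Section Boxes.
Context {R : realType}.

(* [P a b x y] is the number P(a, b | x, y): outputs first, inputs last. *)
Definition box := bool -> bool -> bool -> bool -> R.

Definition nonsignalling (P : box) : Prop :=
  [/\ forall a b x y, 0 <= P a b x y,
      forall x y, \sum_a \sum_b P a b x y = 1,
      forall a x y y', \sum_b P a b x y = \sum_b P a b x y' &
      forall b x x' y, \sum_a P a b x y = \sum_a P a b x' y].

Definition PR : box :=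
  fun a b x y => if a (+) b == x && y then 2^-1 else 0.

Definition PL (mu nu sigma tau : bool) : box :=
  fun a b x y =>
    if (a == (mu && x) (+) nu) && (b == (sigma && y) (+) tau) then 1 else 0.

Definition P0 : box := PL false false false false.
Definition P1 : box := PL false true false true.

Definition Conv (k : nat) (s : k.-tuple box) : set box :=
  [set P | exists w : 'I_k -> R,
     [/\ forall i, 0 <= w i,
         \sum_i w i = 1 &
         forall a b x y, P a b x y = \sum_i w i * tnth s i a b x y]].

End Boxes.

Arguments box R : clear implicits.

(* One party's adaptive use of its sides of N copies, as a decision tree:
   [Use i x w0 w1] gives input bit x to copy i, then continues as w0 or w1
   according to whether the output bit received is 0 or 1. *)
Inductive wiring (N : nat) : Type :=
| Done
| Use (i : 'I_N) (x : bool) (w0 w1 : wiring N).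
Arguments Done {N}.

(* The copies used, in order, when copy j outputs the bit [a j]. *)
Fixpoint used N (w : wiring N) (a : 'I_N -> bool) : seq 'I_N :=
  if w is Use i _ w0 w1 then i :: used (if a i then w1 else w0) a
  else [::].

Definition uses_each_once N (w : wiring N) : Prop :=
  forall a : 'I_N -> bool, perm_eq (used w a) (enum 'I_N).

(* The input given to copy i when copy j outputs [a j]; the [Done] case is
   junk, never reached when every copy is used. *)
Fixpoint input N (w : wiring N) (a : 'I_N -> bool) (i : 'I_N) : bool :=
  if w is Use j x w0 w1 then
    if j == i then x else input (if a j then w1 else w0) a i
  else false.

(* There are countably many wirings and message functions take values in a
   finite type, so the measurability fields only say that all choices are
   measurable functions of the shared randomness, for discrete codomains. *)
Record protocol (R : realType) (n m : nat) := Protocol {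
  copies : nat;
  seed_display : measure_display;
  seed : measurableType seed_display;
  seed_law : probability seed R;
  alice_wiring : n.-tuple bool -> seed -> wiring copies;
  bob_wiring : m.-tuple bool -> seed -> wiring copies;
  bob_message : m.-tuple bool -> seed -> {ffun 'I_copies -> bool} -> bool;
  alice_output :
    n.-tuple bool -> seed -> {ffun 'I_copies -> bool} -> bool -> bool;
  alice_wiring_valid : forall X l, uses_each_once (alice_wiring X l);
  bob_wiring_valid : forall Y l, uses_each_once (bob_wiring Y l);
  alice_wiring_measurable :
    forall X w, measurable [set l | alice_wiring X l = w];
  bob_wiring_measurable :
    forall Y w, measurable [set l | bob_wiring Y l = w];
  bob_message_measurable :
    forall Y b, measurable [set l | bob_message Y l b];
  alice_output_measurable :
    forall X a c, measurable [set l | alice_output X l a c] }.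

Definition outputs_prob (R : realType) (P : box R) N (wA wB : wiring N)
    (a b : {ffun 'I_N -> bool}) : R :=
  \prod_(i < N) P (a i) (b i) (input wA a i) (input wB b i).

(* The probability that Alice outputs the bit v on the strings X and Y. *)
Definition output_prob (R : realType) (P : box R) n m (pi : protocol R n m)
    (X : n.-tuple bool) (Y : m.-tuple bool) (v : bool) : \bar R :=
  \int[seed_law pi]_l
    (\sum_(a : {ffun 'I_(copies pi) -> bool})
      \sum_(b : {ffun 'I_(copies pi) -> bool} |
            alice_output X l a (bob_message Y l b) == v)
        outputs_prob P (alice_wiring X l) (bob_wiring Y l) a b)%:E.

Definition collapsing (R : realType) (P : box R) : Prop :=
  exists2 p : R, 2^-1 < p &
    forall (n m : nat) (f : n.-tuple bool -> m.-tuple bool -> bool),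
    exists pi : protocol R n m,
    forall X Y, (p%:E <= output_prob P pi X Y (f X Y))%E.

(* Main.v *)
(* Write a box of the triangle as [p PR + q Q + r S].  For each of the five
   triples there is a wiring of two copies whose multiplication table (first
   copy, second copy) is
     PR.PR = PR.Q = Q.PR = S.PR = PR,  PR.S = (Q + S) / 2,
     Q.Q = S.S = Q,  Q.S = S.Q = S,
   so it replaces [p] by [p (1 + q)] and [q] by [p r / 2 + q^2 + r^2].  As [p]
   stays bounded by 1, iterating it from any [p > 0] forces [q], then [r], to 0,
   hence [p] to 1.  Since the number of copies may depend on [f], no noise
   tolerant computation is needed: van Dam's protocol computes [f] from [2 ^ m]
   PR boxes, and it succeeds with probability at least 2/3 when they are
   replaced by boxes distilled close enough to PR. *)
Require Import Defs.
From mathcomp Require Import all_boot all_order all_algebra.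
From mathcomp Require Import all_classical all_reals all_analysis.
From mathcomp Require Import ring lra.

Set Implicit Arguments.
Unset Strict Implicit.
Unset Printing Implicit Defensive.

Import Order.TTheory GRing.Theory Num.Theory.

Local Open Scope classical_set_scope.
Local Open Scope ring_scope.

(** * Fixed-order programs and their composition *)

(* One party's strategy on [n] copies used in the fixed order 0, ..., n-1: the
   input bit of the next copy, then a continuation taking its output bit. *)
Fixpoint prog (n : nat) (O : Type) : Type :=
  if n is n'.+1 then (bool * (bool -> prog n' O))%type else O.

Fixpoint bind {n m : nat} {A O : Type} :
    prog n A -> (A -> prog m O) -> prog (n + m) O :=
  match n return prog n A -> (A -> prog m O) -> prog (n + m) O with
  | 0%N => fun p k => k p
  | n'.+1 => fun p k => (p.1, fun a => bind (p.2 a) k)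
  end.

(** [s x] stands for one call with input [x], carried out on [N] copies; expanding all [n] calls
    takes [n * N] copies. *)
Fixpoint subst {N : nat} (s : bool -> prog N bool) {n : nat} {O : Type} :
    prog n O -> prog (n * N) O :=
  match n return prog n O -> prog (n * N) O with
  | 0%N => fun p => p
  | n'.+1 => fun p => bind (s p.1) (fun a => subst s (p.2 a))
  end.

(** * Expectations over box outputs, and simulation of boxes *)

Section Evaluation.
Context {R : realType}.
Implicit Types P Q : box R.

(** Both parties use the copies in the same order, so the expectation of [F] of their results is
    taken one copy at a time. *)
Fixpoint ev P {n : nat} {A B : Type} :
    prog n A -> prog n B -> (A -> B -> R) -> R :=
  match n return prog n A -> prog n B -> (A -> B -> R) -> R with
  | 0%N => fun pA pB F => F pA pB
  | n'.+1 => fun pA pB F =>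
      \sum_a \sum_b P a b pA.1 pB.1 * ev P (pA.2 a) (pB.2 b) F
  end.

Definition ind (a b u v : bool) : R := ((u == a) && (v == b))%:R.

Definition simulates P Q : Prop :=
  exists N (sA sB : bool -> prog N bool),
    forall a b x y, Q a b x y = ev P (sA x) (sB y) (ind a b).

Lemma ev_bind P n m A B C D (pA : prog n A) (pB : prog n B)
    (kA : A -> prog m C) (kB : B -> prog m D) F :
  ev P (bind pA kA) (bind pB kB) F =
  ev P pA pB (fun u v => ev P (kA u) (kB v) F).
Proof.
elim: n pA pB => [//|n IHn] pA pB /=.
by under eq_bigr do under eq_bigr do rewrite IHn.
Qed.

Lemma eq_ev P n A B (pA : prog n A) (pB : prog n B) F G :
  (forall u v, F u v = G u v) -> ev P pA pB F = ev P pA pB G.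
Proof.
move=> FG; elim: n pA pB => [|n IHn] pA pB /=; first exact: FG.
by under eq_bigr do under eq_bigr do rewrite IHn.
Qed.

Lemma ev_ind P n (pA pB : prog n bool) F :
  ev P pA pB F = \sum_u \sum_v ev P pA pB (ind u v) * F u v.
Proof.
elim: n pA pB => [|n IHn] pA pB /=.
  by rewrite !big_bool /ind; case: pA; case: pB => /=; ring.
under eq_bigr do under eq_bigr do rewrite IHn.
by rewrite !big_bool /=; ring.
Qed.

(** By [ev_ind], a simulated call enters the rest of the computation only through the law of its two
    output bits, which is [Q]. *)
Lemma ev_subst P Q N (sA sB : bool -> prog N bool) n A B (pA : prog n A)
    (pB : prog n B) F :
  (forall a b x y, Q a b x y = ev P (sA x) (sB y) (ind a b)) ->
  ev P (subst sA pA) (subst sB pB) F = ev Q pA pB F.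
Proof.
move=> QE; elim: n pA pB => [//|n IHn] pA pB /=.
rewrite ev_bind (eq_ev _ _ _ (fun u v => IHn (pA.2 u) (pB.2 v))) ev_ind.
by apply: eq_bigr => a _; apply: eq_bigr => b _; rewrite QE.
Qed.

Lemma simulates_refl P : simulates P P.
Proof.
exists 1%N, (fun x => (x, fun a => a)), (fun y => (y, fun b => b)).
move=> a b x y /=; rewrite !big_bool /ind.
by case: a; case: b => /=; ring.
Qed.

Lemma simulates_trans P Q S : simulates P Q -> simulates Q S -> simulates P S.
Proof.
move=> [N [sA [sB QE]]] [M [tA [tB SE]]].
exists (M * N)%N, (fun x => subst sA (tA x)), (fun y => subst sB (tB y)).
by move=> a b x y; rewrite (ev_subst _ _ _ QE) SE.
Qed.

Lemma PR_ge0 a b x y : 0 <= PR a b x y :> R.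
Proof. by rewrite /PR; case: ifP => // _; lra. Qed.

Lemma PL_ge0 mu nu sigma tau a b x y : 0 <= PL mu nu sigma tau a b x y :> R.
Proof. by rewrite /PL; case: ifP. Qed.

Lemma ev_ge0 P n A B (pA : prog n A) (pB : prog n B) F :
  (forall a b x y, 0 <= P a b x y) -> (forall u v, 0 <= F u v) ->
  0 <= ev P pA pB F.
Proof.
move=> P0 F0; elim: n pA pB => [|n IHn] pA pB /=; first exact: F0.
by do 2![apply: sumr_ge0 => ? _]; rewrite mulr_ge0.
Qed.

(** Each term contains [n] box values, each losing at most a factor [c]; nonnegativity lets these
    bounds multiply. *)
Lemma ev_near P Q c n A B (pA : prog n A) (pB : prog n B) F :
  0 <= c -> (forall a b x y, 0 <= P a b x y) -> (forall u v, 0 <= F u v) ->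
  (forall a b x y, c * P a b x y <= Q a b x y) ->
  c ^+ n * ev P pA pB F <= ev Q pA pB F.
Proof.
move=> c0 P0 F0 PQ; elim: n pA pB => [|n IHn] pA pB /=; first by rewrite mul1r.
rewrite mulr_sumr; apply: ler_sum => a _.
rewrite mulr_sumr; apply: ler_sum => b _.
rewrite exprS mulrACA; apply: ler_pM => //; rewrite mulr_ge0 ?exprn_ge0 //.
exact: ev_ge0.
Qed.

(* Van Dam: one PR box per term of an inner product modulo 2. *)
Fixpoint xor_prog (n : nat) (h : nat -> bool) (acc : bool) : prog n bool :=
  match n return prog n bool with
  | 0%N => acc
  | n'.+1 => (h 0%N, fun a => xor_prog n' (h \o S) (acc (+) a))
  end.

(** Each accumulator alone is randomised by the PR boxes; only their XOR is determined, hence the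
    restriction to functions of [a (+) b]. *)
Lemma ev_xor_prog n hA hB u v (G : bool -> R) :
  ev PR (xor_prog n hA u) (xor_prog n hB v) (fun a b => G (a (+) b)) =
  G (u (+) v (+) \big[addb/false]_(i < n) (hA i && hB i)).
Proof.
elim: n hA hB u v => [|n IHn] hA hB u v /=; first by rewrite big_ord0 addbF.
under eq_bigr do under eq_bigr do rewrite IHn.
rewrite big_ord_recl !big_bool /PR /=.
under [in RHS]eq_bigr do rewrite /bump /= add1n.
set s := \big[_/_]_(i < n) _.
by case: (hA 0%N); case: (hB 0%N); case: u; case: v; case: s => /=; field.
Qed.

End Evaluation.

(** * From programs to wirings and protocols *)

Section Wirings.
Context {R : realType}.

(** [j] names the copies still to be used: [N] stays fixed while the program shrinks. *)
Fixpoint to_wiring {N n : nat} {O : Type} :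
    prog n O -> ('I_n -> 'I_N) -> wiring N :=
  match n return prog n O -> ('I_n -> 'I_N) -> wiring N with
  | 0%N => fun _ _ => Done
  | n'.+1 => fun p j =>
      Use (j ord0) p.1 (to_wiring (p.2 false) (j \o lift ord0))
                       (to_wiring (p.2 true) (j \o lift ord0))
  end.

Fixpoint result {n : nat} {O : Type} : prog n O -> ('I_n -> bool) -> O :=
  match n return prog n O -> ('I_n -> bool) -> O with
  | 0%N => fun p _ => p
  | n'.+1 => fun p a => result (p.2 (a ord0)) (a \o lift ord0)
  end.

Lemma used_to_wiring N n O (p : prog n O) (j : 'I_n -> 'I_N) a :
  used (to_wiring p j) a = [seq j i | i <- enum 'I_n].
Proof.
elim: n p j => [|n IHn] p j /=.
  by rewrite (size0nil (s := enum 'I_0)) // size_enum_ord.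
rewrite enum_ordSl /= -map_comp; congr (_ :: _).
by case: (a _); rewrite IHn.
Qed.

Lemma uses_each_once_to_wiring n O (p : prog n O) :
  uses_each_once (to_wiring p id).
Proof. by move=> a; rewrite used_to_wiring map_id. Qed.

Lemma sum_ffun_ord0 (F : {ffun 'I_0 -> bool} -> R) :
  \sum_a F a = F [ffun=> false].
Proof.
rewrite (bigD1 [ffun=> false]) //= big1 ?addr0 // => a /negP[].
by apply/eqP/ffunP => -[].
Qed.

Lemma sum_ffun_ordS n (F : {ffun 'I_n.+1 -> bool} -> R) :
  \sum_a F a =
  \sum_a0 \sum_(a : {ffun 'I_n -> bool})
     F [ffun i => if unlift ord0 i is Some i' then a i' else a0].
Proof.
rewrite pair_bigA /=.
rewrite (reindex (fun c : bool * {ffun 'I_n -> bool} =>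
  [ffun i => if unlift ord0 i is Some i' then c.2 i' else c.1])) //=.
exists (fun a : {ffun 'I_n.+1 -> bool} => (a ord0, [ffun i => a (lift ord0 i)])).
  move=> [a0 a] _ /=; rewrite ffunE unlift_none; congr pair.
  by apply/ffunP => i; rewrite !ffunE liftK.
move=> a _; apply/ffunP => i; rewrite ffunE /=.
by case: unliftP => [k|] -> //; rewrite ffunE.
Qed.

(** Indexed by position instead of searching a wiring for a copy, so that it unfolds along with
    [ev]. *)
Fixpoint inputs {n : nat} {O : Type} :
    prog n O -> ('I_n -> bool) -> 'I_n -> bool :=
  match n return prog n O -> ('I_n -> bool) -> 'I_n -> bool with
  | 0%N => fun _ _ _ => false
  | n'.+1 => fun p a i =>
      if unlift ord0 i is Some i' then
        inputs (p.2 (a ord0)) (a \o lift ord0) i'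
      else p.1
  end.

Lemma input_to_wiring N n O (p : prog n O) (j : 'I_n -> 'I_N) a i :
  injective j -> input (to_wiring p j) a (j i) = inputs p (a \o j) i.
Proof.
elim: n p j i => [p j []//|n IHn] p j i jI /=.
rewrite (inj_eq jI); case: unliftP => [k|] -> //=.
by case: (a _); rewrite (IHn _ (j \o lift ord0)) //;
  apply: inj_comp => //; exact: lift_inj.
Qed.

(** The factor of the first copy splits off the product, and the other factors form the same sum for
    the continuations. *)
Lemma sum_outputs (P : box R) n A B (pA : prog n A) (pB : prog n B)
    (F : A -> B -> R) :
  \sum_(a : {ffun 'I_n -> bool}) \sum_(b : {ffun 'I_n -> bool})
    (\prod_(i < n) P (a i) (b i) (inputs pA a i) (inputs pB b i)) *
    F (result pA a) (result pB b) = ev P pA pB F.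
Proof.
elim: n pA pB => [|n IHn] pA pB.
  by rewrite !sum_ffun_ord0 big_ord0 mul1r.
rewrite sum_ffun_ordS /=; apply: eq_bigr => a0 _.
under eq_bigr do rewrite sum_ffun_ordS.
rewrite exchange_big /=; apply: eq_bigr => b0 _.
rewrite -IHn mulr_sumr; apply: eq_bigr => a _.
rewrite mulr_sumr; apply: eq_bigr => b _.
rewrite big_ord_recl /= unlift_none !ffunE !unlift_none mulrA.
have tailE (c0 : bool) (c : {ffun 'I_n -> bool}) :
    [ffun i => if unlift ord0 i is Some i' then c i' else c0] \o lift ord0 =
    c :> ('I_n -> bool).
  by apply: funext => i /=; rewrite ffunE liftK.
rewrite !tailE; congr (_ * _ * _); apply: eq_bigr => i _.
by rewrite liftK !ffunE liftK.
Qed.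

Lemma sum_outputs_prob (P : box R) n A B (pA : prog n A) (pB : prog n B)
    (E : A -> B -> bool) :
  \sum_(a : {ffun 'I_n -> bool})
    \sum_(b : {ffun 'I_n -> bool} | E (result pA a) (result pB b))
      outputs_prob P (to_wiring pA id) (to_wiring pB id) a b =
  ev P pA pB (fun u v => (E u v)%:R).
Proof.
rewrite -sum_outputs; apply: eq_bigr => a _.
rewrite big_mkcond; apply: eq_bigr => b _.
rewrite mulr_natr mulrb; case: ifP => // _.
by apply: eq_bigr => i _; rewrite !(input_to_wiring _ (j := id)).
Qed.

(** * Van Dam's protocol with boxes close to PR *)

Lemma bernoulli_ineq (e : R) n : 0 <= e <= 1 -> 1 - n%:R * e <= (1 - e) ^+ n.
Proof.
move=> /andP[e0 e1]; elim: n => [|n IHn]; first by rewrite mul0r subr0.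
rewrite exprS -natr1; apply: le_trans (ler_wpM2l _ IHn); last lra.
have : 0 <= n%:R * e ^+ 2 by rewrite mulr_ge0 ?exprn_ge0.
by rewrite expr2; nra.
Qed.

(** Alice's vector lists [f X Z] over all strings [Z], and Bob's is the indicator of [Y]. *)
Lemma inner_product_form n m (f : n.-tuple bool -> m.-tuple bool -> bool) :
  exists M (hA : n.-tuple bool -> nat -> bool)
           (hB : m.-tuple bool -> nat -> bool),
    forall X Y, \big[addb/false]_(i < M) (hA X i && hB Y i) = f X Y.
Proof.
pose e := enum {: m.-tuple bool}; pose Z := nth [tuple of nseq m false] e.
exists (size e), (fun X i => f X (Z i)), (fun Y i => Z i == Y) => X Y.
rewrite -(big_mkord xpredT (fun i => f X (Z i) && (Z i == Y))).
rewrite -(big_nth _ xpredT (fun y => f X y && (y == Y))) big_enum /=.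
rewrite (bigD1 Y) //= eqxx andbT big1 ?addbF // => y /negbTE ->.
by rewrite andbF.
Qed.

Definition deterministic_protocol n m N (A B : Type) (msg : B -> bool)
    (out : A -> bool -> bool) (pA : n.-tuple bool -> prog N A)
    (pB : m.-tuple bool -> prog N B) : protocol R n m.
Proof.
refine (@Protocol R n m N default_measure_display unit (dirac tt)
  (fun X _ => to_wiring (pA X) id) (fun Y _ => to_wiring (pB Y) id)
  (fun Y _ b => msg (result (pB Y) b))
  (fun X _ a c => out (result (pA X) a) c)
  (fun X _ => uses_each_once_to_wiring _)
  (fun Y _ => uses_each_once_to_wiring _) _ _ _ _) => *; exact: I.
Defined.

Lemma output_prob_deterministic (P : box R) n m N (A B : Type)
    (msg : B -> bool) (out : A -> bool -> bool)
    (pA : n.-tuple bool -> prog N A) (pB : m.-tuple bool -> prog N B) X Y v :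
  output_prob P (deterministic_protocol msg out pA pB) X Y v =
  (ev P (pA X) (pB Y) (fun a b => (out a (msg b) == v)%:R))%:E.
Proof.
rewrite /output_prob /= integral_dirac //= diracT mul1e.
congr EFin; exact: (sum_outputs_prob P _ _ (fun a b => out a (msg b) == v)).
Qed.

Lemma collapsing_of_near_PR (P : box R) :
  (forall e, 0 < e -> e <= 1 -> exists2 Q, simulates P Q &
     forall a b x y, (1 - e) * PR a b x y <= Q a b x y) ->
  collapsing P.
Proof.
move=> nearP; exists (2 / 3); first lra.
move=> n m f; have [M [hA [hB fE]]] := inner_product_form f.
have M1 : 0 < M.+1%:R :> R by rewrite ltr0n.
(* The success probability is at least [(1 - e) ^+ M >= 1 - M e], so [M e <= 1/3] suffices; [M.+1]
   keeps the denominator positive for [M = 0]. *)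
pose e : R := (3 * M.+1%:R)^-1.
have Me : M%:R * e <= 3^-1.
  rewrite /e invfM mulrCA ler_piMr ?invr_ge0 //.
  by rewrite ler_pdivrMr // mul1r ler_nat.
have e0 : 0 < e by rewrite invr_gt0 mulr_gt0.
have e1 : e <= 1.
  rewrite invf_le1 ?mulr_gt0 //.
  have : 1 <= M.+1%:R :> R by rewrite ler1n.
  lra.
have [Q [N [sA [sB QE]]] nearQ] := nearP e e0 e1.
exists (deterministic_protocol id addb
  (fun X => subst sA (xor_prog M (hA X) false))
  (fun Y => subst sB (xor_prog M (hB Y) false))) => X Y.
rewrite output_prob_deterministic lee_fin (ev_subst _ _ _ QE).
set F : bool -> bool -> R := fun a b => _.
have F0 a b : 0 <= F a b by exact: ler0n.
have evPR : ev PR (xor_prog M (hA X) false) (xor_prog M (hB Y) false) F = 1.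
  by rewrite (ev_xor_prog M _ _ _ _ (fun c => (c == f X Y)%:R)) fE eqxx.
have c0 : 0 <= 1 - e by lra.
have := ev_near (xor_prog M (hA X) false) (xor_prog M (hB Y) false)
  c0 PR_ge0 F0 nearQ.
rewrite evPR mulr1; apply: le_trans.
apply: le_trans (bernoulli_ineq _ _); first lra.
by rewrite (ltW e0).
Qed.

End Wirings.

(** * Distillation by wirings of two copies *)

Section Distillation.
Context {R : realType}.
Implicit Types Q S : box R.

Definition mix Q S (p q r : R) : box R :=
  fun a b x y => p * PR a b x y + q * Q a b x y + r * S a b x y.

(* The first copy receives the party's own input [x], the second [h x a1]. *)
Definition two_copies (h g : bool -> bool -> bool) (x : bool) : prog 2 bool :=
  (x, fun a1 => (h x a1, fun a2 => g a1 a2)).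

(** PR with [Q] gives PR in both orders, PR with [S] in one order only: this yields
    [p (p + 2 q + r)], which is [p * (1 + q)] since the weights sum to 1. *)
Definition distills Q S (hA gA hB gB : bool -> bool -> bool) : Prop :=
  forall p q r, p + q + r = 1 -> forall a b x y,
    mix Q S (p * (1 + q)) (p * r / 2 + q ^+ 2 + r ^+ 2) (p * r / 2 + 2 * q * r)
      a b x y =
    ev (mix Q S p q r) (two_copies hA gA x) (two_copies hB gB y) (ind a b).

Let and_not x a := x && ~~ a.
Let second (a1 a2 : bool) := a2.

(** With [p] eliminated, each of the 16 values of the bits leaves a polynomial identity in [q] and
    [r]. *)
Ltac check_distills :=
  move=> p q r pqr; (have -> : p = 1 - q - r by lra);
  by do 4![case]; rewrite /= !big_bool /mix /PR /P0 /P1 /PL /ind /=; field.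

(** On two PR boxes with [x = y = 1], exactly one first output is 1, so one second input is 0 and
    the XOR stays 1. *)
Lemma distills_P0_P1 : distills P0 P1 and_not addb and_not addb.
Proof. check_distills. Qed.

(** On two PR boxes with [y = 1], the second inputs are [x (+) a1 = b1] and [~~ b1], whose product
    is 0. *)
Lemma distills_P0_PL0111 :
  distills P0 (PL false true true true) addb addb and_not addb.
Proof. check_distills. Qed.

(** The previous wiring with the parties exchanged. *)
Lemma distills_P0_PL1101 :
  distills P0 (PL true true false true) and_not addb addb addb.
Proof. check_distills. Qed.

(** On two PR boxes the XOR is [a1 (+) ((x || a1) && b1)]: for [x = 1] it is [a1 (+) b1 = y], and
    for [x = 0] it is 0 because [b1 = a1]. *)
Lemma distills_PL0010_PL1011 :
  distills (PL false false true false) (PL true false true true)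
    orb addb second second.
Proof. check_distills. Qed.

(** Again the previous wiring with the parties exchanged. *)
Lemma distills_PL1000_PL1110 :
  distills (PL true false false false) (PL true true true false)
    second second orb addb.
Proof. check_distills. Qed.

Definition weights (p q r : R) : Prop :=
  [/\ 0 <= p, 0 <= q, 0 <= r & p + q + r = 1].

(* The PR weight grows by the factor [1 + q]; when [q] is negligible and the
   PR weight is not yet near 1, [r] is not negligible and makes the next [q] at
   least [p * r / 2], so that two steps gain at least [p0 * d]. *)
Lemma distills_near_PR Q S hA gA hB gB (p0 q0 r0 e : R) :
  distills Q S hA gA hB gB -> weights p0 q0 r0 -> 0 < p0 -> 0 < e -> e <= 1 ->
  exists p q r, [/\ weights p q r, 1 - e <= p &
    simulates (mix Q S p0 q0 r0) (mix Q S p q r)].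
Proof.
move=> dist w0 p0_gt0 e0 e1.
have step p q r : weights p q r ->
  let p' := p * (1 + q) in
  let q' := p * r / 2 + q ^+ 2 + r ^+ 2 in
  let r' := p * r / 2 + 2 * q * r in
  [/\ weights p' q' r', p' = p + p * q, p * r / 2 <= q' &
     simulates (mix Q S p q r) (mix Q S p' q' r')].
  move=> [p_ge0 q_ge0 r_ge0 pqr] /=.
  have pq : 0 <= p * q by rewrite mulr_ge0.
  have pr : 0 <= p * r by rewrite mulr_ge0.
  have qr : 0 <= q * r by rewrite mulr_ge0.
  have q2 : 0 <= q ^+ 2 by rewrite exprn_ge0.
  have r2 : 0 <= r ^+ 2 by rewrite exprn_ge0.
  split; [split; try lra|by rewrite mulrDr mulr1|lra|].
    have -> : p = 1 - q - r by lra.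
    by field.
  exists 2%N, (two_copies hA gA), (two_copies hB gB); exact: dist.
(* If [p < 1 - e] and [q < d <= e / 4], then [r > 3 e / 4], and the next [q] is at least
   [p r / 2 >= 3 p0 e / 8 >= d]. *)
pose d := p0 * e / 4.
have d0 : 0 < d by rewrite !mulr_gt0.
have p0d : 0 < p0 * d by rewrite mulr_gt0.
have climb k : exists p q r, [/\ weights p q r, p0 <= p,
    1 - e <= p \/ p0 + k%:R * (p0 * d) <= p &
    simulates (mix Q S p0 q0 r0) (mix Q S p q r)].
  elim: k => [|k [p [q [r [w p0p far sim]]]]].
    exists p0, q0, r0; split => //; last exact: simulates_refl.
    by right; rewrite mul0r addr0.
  have [pe|pe] := leP (1 - e) p; first by exists p, q, r; split => //; left.
  have {}far : p0 + k%:R * (p0 * d) <= p.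
    by case: far => // /le_lt_trans/(_ pe); rewrite ltxx.
  have [w1 pE q1_ge sim1] := step _ _ _ w.
  have [p_ge0 q_ge0 r_ge0 pqr] := w.
  have pq : 0 <= p * q by rewrite mulr_ge0.
  have [dq|qd] := leP d q.
    have : p0 * d <= p * q by rewrite ler_pM // ltW.
    move=> gain; do 3!eexists; split; [exact: w1| | |
      exact: simulates_trans sim sim1]; first lra.
    by right; rewrite -natr1; lra.
  move: w1 pE q1_ge sim1; set p1 := p * _; set q1 := _ + r ^+ 2; set r1 := _ + _.
  move=> w1 pE q1_ge sim1.
  have [w2 p2E _ sim2] := step _ _ _ w1.
  have p0_le1 : p0 <= 1 by case: w0; lra.
  have d_le : d <= e / 4 by rewrite /d; nra.
  have r_big : 3 * e / 4 <= r by lra.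
  have dq1 : d <= q1.
    have : p0 * (3 * e / 4) <= p * r by rewrite ler_pM //; lra.
    by move: d0; rewrite /d; lra.
  have : p0 * d <= p1 * q1 by rewrite ler_pM //; lra.
  move=> gain; do 3!eexists; split; [exact: w2| | |
    exact: simulates_trans (simulates_trans sim sim1) sim2]; first lra.
  by right; rewrite -natr1; lra.
(* For this many gains of [p0 * d], the second alternative would force [p > 1]. *)
have [p [q [r [w _ [pe|far] sim]]]] := climb (Num.bound (p0 * d)^-1).
  by exists p, q, r.
have [p_ge0 q_ge0 r_ge0 pqr] := w.
have : 1 < (Num.bound (p0 * d)^-1)%:R * (p0 * d).
  rewrite -ltr_pdivrMr // mul1r; apply: archi_boundP.
  by rewrite invr_ge0 ltW.
lra.
Qed.

Lemma collapsing_of_distills Q S hA gA hB gB (B : box R) :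
  distills Q S hA gA hB gB ->
  (forall a b x y, 0 <= Q a b x y) -> (forall a b x y, 0 <= S a b x y) ->
  (Conv [tuple PR; Q; S] `\` Conv [tuple Q; S]) B -> collapsing B.
Proof.
move=> dist Q0 S0 [[w [w0 wsum BE]] notQS].
pose p := w ord0; pose q := w (inord 1); pose r := w (inord 2).
have ordE (F : 'I_3 -> R) : \sum_i F i = F ord0 + F (inord 1) + F (inord 2).
  rewrite !big_ord_recl big_ord0 addr0 addrA.
  by congr (_ + F _ + F _); apply: val_inj; rewrite /= inordK.
have {}BE : B = mix Q S p q r.
  apply: funext => a; apply: funext => b; apply: funext => x; apply: funext => y.
  by rewrite BE ordE !(tnth_nth PR) !inordK.
have pqr : weights p q r by split; rewrite ?w0 // -wsum ordE.
have p_gt0 : 0 < p.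
  (* With PR weight 0 the box would lie on the excluded edge. *)
  rewrite lt_def w0 andbT; apply/eqP => p_eq0; apply: notQS.
  have [_ _ _] := pqr; rewrite p_eq0 add0r => qr.
  exists (fun i : 'I_2 => if val i == 0%N then q else r); split.
  - by move=> i; case: ifP => _; exact: w0.
  - by rewrite !big_ord_recl big_ord0 addr0.
  - move=> a b x y; rewrite !big_ord_recl big_ord0 addr0 !(tnth_nth PR) /=.
    by rewrite BE /mix p_eq0 mul0r add0r.
apply: collapsing_of_near_PR => e e0 e1.
have [p' [q' [r' [[p'0 q'0 r'0 _] pe sim]]]] :=
  distills_near_PR dist pqr p_gt0 e0 e1.
exists (mix Q S p' q' r'); first by rewrite BE.
(* The [Q] and [S] parts are nonnegative, so dropping them leaves a lower bound. *)
move=> a b x y; rewrite /mix -addrA; apply: ler_wpDr.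
  by rewrite addr_ge0 ?mulr_ge0.
by rewrite ler_wpM2r ?PR_ge0.
Qed.

End Distillation.

Unset Implicit Arguments.

Theorem theorem29 (R : realType) (P Q S : box R)
  (hPQS : (P, Q, S) \in
    [:: (PR, P0, P1);
        (PR, P0, PL false true true true);
        (PR, P0, PL true true false true);
        (PR, PL false false true false, PL true false true true);
        (PR, PL true false false false, PL true true true false)])
  (B : box R) (hB : nonsignalling B)
  (hconv : (Conv [tuple P; Q; S] `\` Conv [tuple Q; S]) B) :
  collapsing B.
Proof.
move: hPQS hconv; rewrite !inE.
case/or4P => [| | |/orP[]] /eqP[-> -> ->] hconv.
- exact: (collapsing_of_distills distills_P0_P1 (@PL_ge0 _ _ _ _ _)
    (@PL_ge0 _ _ _ _ _) hconv).
- exact: (collapsing_of_distills distills_P0_PL0111 (@PL_ge0 _ _ _ _ _)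
    (@PL_ge0 _ _ _ _ _) hconv).
- exact: (collapsing_of_distills distills_P0_PL1101 (@PL_ge0 _ _ _ _ _)
    (@PL_ge0 _ _ _ _ _) hconv).
- exact: (collapsing_of_distills distills_PL0010_PL1011 (@PL_ge0 _ _ _ _ _)
    (@PL_ge0 _ _ _ _ _) hconv).
- exact: (collapsing_of_distills distills_PL1000_PL1110 (@PL_ge0 _ _ _ _ _)
    (@PL_ge0 _ _ _ _ _) hconv).
Qed.
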